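(* Let $\mathbf b = (b_1,b_2)\in\mathbb{C}^2$, and let $\mathcal{M}_{\mathbf b}\subset\mathbb{C}^8$ be the relative $\mathrm{SL}(2,\mathbb{C})$-representation variety of the two-holed torus with boundary traces $b_1,b_2$, i.e. the affine scheme in the coordinates $x_1,x_2,x_3,x_{12},x_{13},x_{23},t_1,t_2$ defined by the ideal $I_{\mathbf b} = (t_1-b_1,\ t_2-b_2,\ u_2,\ u_s)$. Then $\mathcal{M}_{\mathbf b}$ is singular if and only if $\psi_2(\mathbf b)=0$, where $$\psi_2(y_1,y_2) = (y_1^2-4)(y_2^2-4)(y_1-y_2)^2.$$
   Context: The polynomials are $$\begin{aligned} u_2 ={}& 4-x_1^2-x_2^2-x_3^2-x_1x_2x_3t_1-t_1^2+x_1x_2x_{12}+x_3t_1x_{12}-x_{12}^2+x_1x_3x_{13}+x_2t_1x_{13}-x_{13}^2\\ &+x_2x_3x_{23}+x_1t_1x_{23}-x_{12}x_{13}x_{23}-x_{23}^2,\\ u_s={}& t_1+t_2-(x_3x_{12}+x_2x_{13}+x_1x_{23}-x_1x_2x_3).\end{aligned}$$ (The fundamental group is free on $F_1,F_2,F_3$; $x_i=\mathrm{tr}\,\rho(F_i)$, $x_{ij}=\mathrm{tr}\,\rho(F_iF_j)$ for $i<j$; the two punctures correspond to $F_1F_2F_3$ and $F_1F_3F_2$, with $t_1=\mathrm{tr}\,\rho(F_1F_2F_3)$, $t_2=\mathrm{tr}\,\rho(F_1F_3F_2)$.) For an ideal $I=(\phi_1,\dots,\phi_k)$ of codimension $c$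 in a polynomial ring $\mathcal{O}$ over $\mathbb{C}$, $\mathrm{Spec}(\mathcal{O}/I)$ is smooth if and only if $I$ plus the ideal generated by the $c\times c$ minors of the Jacobian matrix of the $\phi_i$ equals $\mathcal{O}$; singular means not smooth. *)

(* Defs.v *)
From HB Require Import structures.
From mathcomp Require Import all_boot all_order all_algebra.
From mathcomp Require Import boolp classical_sets reals.
From mathcomp Require Import complex.
From mathcomp Require Import mpoly.

Set Implicit Arguments.
Unset Strict Implicit.
Unset Printing Implicit Defensive.

Import GRing.Theory.

Local Open Scope ring_scope.
Local Open Scope classical_set_scope.

Section Ideals.
Variable A : comNzRingType.

(* The improper ideal [set: A] is allowed, unlike in [idealr_closed]. *)
Definition is_ideal (I : set A) : Prop :=
  [/\ I 0, forall p q, I p -> I q -> I (p + q) & forall a p, I p -> I (a * p)].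

Definition ideal_gen (S : set A) : set A := smallest is_ideal S.

Definition is_prime_ideal (P : set A) : Prop :=
  [/\ is_ideal P, ~ P 1 & forall p q, P (p * q) -> P p \/ P q].

(* There are primes Q_0 < Q_1 < ... < Q_c = P; only Q 0, ..., Q c matter. *)
Definition height_ge (P : set A) (c : nat) : Prop :=
  exists Q : nat -> set A,
    [/\ forall i, (i <= c)%N -> is_prime_ideal (Q i),
        forall i, (i < c)%N -> Q i `<` Q i.+1
      & Q c = P].

(* The codimension (height) of I is the least height of a prime containing I.
   It is not defined for the improper ideal, which no prime contains. *)
Definition codimension (I : set A) (c : nat) : Prop :=
  (forall P, is_prime_ideal P -> I `<=` P -> height_ge P c) /\
  (exists P, [/\ is_prime_ideal P, I `<=` P & ~ height_ge P c.+1]).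

End Ideals.

Section Jacobian.
Variables (K : fieldType) (n k : nat) (phi : k.-tuple {mpoly K[n]}).

Definition jacobian : 'M[{mpoly K[n]}]_(k, n) :=
  \matrix_(i < k, j < n) (tnth phi i)^`M(j).

Definition jacobian_minors (c : nat) : set {mpoly K[n]} :=
  [set m | exists (f : 'I_c -> 'I_k) (g : 'I_c -> 'I_n),
     [/\ {homo f : i j / (i < j)%N}, {homo g : i j / (i < j)%N}
       & m = \det (mxsub f g jacobian)]].

Definition generated_ideal : set {mpoly K[n]} := ideal_gen [set` phi].

(* A proper ideal of {mpoly K[n]} has exactly one codimension; the improper
   ideal has none, and its (empty) spectrum is smooth. *)
Definition smooth : Prop :=
  forall c, codimension generated_ideal c ->
    ideal_gen (generated_ideal `|` jacobian_minors c) = [set: {mpoly K[n]}].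

Definition singular : Prop := ~ smooth.

End Jacobian.

Section TwoHoledTorus.
Variable K : fieldType.

Definition x1 : {mpoly K[8]} := 'X_(@Ordinal 8 0 isT).
Definition x2 : {mpoly K[8]} := 'X_(@Ordinal 8 1 isT).
Definition x3 : {mpoly K[8]} := 'X_(@Ordinal 8 2 isT).
Definition x12 : {mpoly K[8]} := 'X_(@Ordinal 8 3 isT).
Definition x13 : {mpoly K[8]} := 'X_(@Ordinal 8 4 isT).
Definition x23 : {mpoly K[8]} := 'X_(@Ordinal 8 5 isT).
Definition t1 : {mpoly K[8]} := 'X_(@Ordinal 8 6 isT).
Definition t2 : {mpoly K[8]} := 'X_(@Ordinal 8 7 isT).

Definition u2 : {mpoly K[8]} :=
  4%:R - x1 ^+ 2 - x2 ^+ 2 - x3 ^+ 2 - x1 * x2 * x3 * t1 - t1 ^+ 2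
  + x1 * x2 * x12 + x3 * t1 * x12 - x12 ^+ 2
  + x1 * x3 * x13 + x2 * t1 * x13 - x13 ^+ 2
  + x2 * x3 * x23 + x1 * t1 * x23 - x12 * x13 * x23 - x23 ^+ 2.

Definition us : {mpoly K[8]} :=
  t1 + t2 - (x3 * x12 + x2 * x13 + x1 * x23 - x1 * x2 * x3).

(* Generators of the ideal of the relative representation variety M_b. *)
Definition rel_rep_gens (b1 b2 : K) : 4.-tuple {mpoly K[8]} :=
  [tuple t1 - b1%:MP; t2 - b2%:MP; u2; us].

Definition psi2 (y1 y2 : K) : K :=
  (y1 ^+ 2 - 4%:R) * (y2 ^+ 2 - 4%:R) * (y1 - y2) ^+ 2.

End TwoHoledTorus.

(* Main.v *)
From HB Require Import structures.
Require Import Defs.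
From mathcomp Require Import all_boot all_order all_algebra.
From mathcomp Require Import reals complex.
From mathcomp Require Import boolp classical_sets mpoly.
From mathcomp Require Import generic_quotient ring_quotient ring.

Set Implicit Arguments.
Unset Strict Implicit.
Unset Printing Implicit Defensive.

Import GRing.Theory Num.Theory.

Local Open Scope ring_scope.
Local Open Scope classical_set_scope.

(** Put [a, b, c = x1, x2, x3] and [p, q, r = x23, x13, x12], and let [S] and
    [Pi] be the polynomials in these six variables such that
    [us = t1 + t2 - S] and [u2 = - (t1 ^ 2 - S * t1 + Pi)].  The variety
    is thus the fibre [S = b1 + b2, Pi = b1 * b2] in six-dimensional space; this
    fibre has codimension two, so its singular points are those where the
    gradients of [S] and [Pi] are parallel.

    Critical points.  The discriminant [S ^ 2 - 4 Pi] is the determinant of the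
    Gram matrix of the matrices [1, F1, F2, F3] for the form [tr (X * adj Y)].
    If [grad Pi = m * grad S], then differentiating this determinant shows
    that the off-diagonal entries of the adjugate of the Gram matrix are explicit
    multiples of [S - 2 m].  Since the Gram matrix times its adjugate is
    [(b1 - b2) ^ 2] times the identity, either [b1 = b2], or all six coordinates
    vanish, or [(p, q, r) = k (a, b, c)] with [k = 1] or [k = -1]; in the last
    two cases one of [b1, b2] is [2] or [-2] ([psi2_of_critical]).  For the
    ideal-theoretic definition of smoothness: an ideal that does not contain [1]
    lies in a prime, and the argument is run in the fraction field of the
    quotient by that prime ([residue_field], [critical_psi2]).  Conversely
    each factor of [psi2] has an explicit critical point
    ([singular_of_diagonal], [singular_of_equal]).

    Codimension four ([rel_rep_codimension]).  Every prime [P] over the ideal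
    has height at least four: under [P] lie the zero ideal, [(t1 - b1)],
    [(t1 - b1, t2 - b2)], and a fourth prime obtained by solving [us = 0] for
    [x12] when [x3] is not in [P], or by adding [x3] when it is
    ([rel_rep_height_ge]).  In the other direction, the projection of the
    variety to [(x1, x2, x3, x13)] is dominant, since its fibres are given by a
    linear and a quadratic equation; hence some prime over the ideal keeps these
    four coordinates algebraically independent ([dominant_component]).  Each
    step down a chain of primes adds one algebraically independent element, and
    a polynomial ring in eight variables has no nine of them, so this prime has
    height at most four ([height_trdeg]). *)

(** * Ideals, primes and residue fields *)

Section IdealTheory.
Variable A : comNzRingType.
Implicit Types (I P S : set A) (p q : A).

Lemma ideal_gen_ideal S : is_ideal (ideal_gen S).
Proof.
split=> [J [[J0 _ _] _] //|p q Sp Sq J JS|a p Sp J JS].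
  by have [[_ JD _] _] := JS; apply: JD; [apply: Sp | apply: Sq].
by have [[_ _ JM] _] := JS; apply: JM; apply: Sp.
Qed.

Lemma sub_ideal_gen S : S `<=` ideal_gen S.
Proof. exact: sub_gen_smallest. Qed.

Lemma ideal_gen_min S I : is_ideal I -> S `<=` I -> ideal_gen S `<=` I.
Proof. exact: smallest_sub. Qed.

Lemma prime_ideal_kernel (D : idomainType) (f : {rmorphism A -> D}) :
  is_prime_ideal [set p | f p = 0].
Proof.
split=> [||p q /eqP] /=.
- split=> [|p q /= fp fq|a p /= fp]; first exact: rmorph0.
    by rewrite rmorphD fp fq addr0.
  by rewrite rmorphM fp mulr0.
- by rewrite rmorph1 => /eqP; rewrite oner_eq0.
- by rewrite rmorphM mulf_eq0 => /orP[] /eqP; [left | right].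
Qed.

Lemma prime_idealX P s n : is_prime_ideal P -> P (s ^+ n) -> P s.
Proof.
move=> [_ P1 PM]; elim: n => [|n IHn]; first by rewrite expr0.
by rewrite exprS => /PM [].
Qed.

(** Krull: an ideal maximal among those that contain [I] and avoid [S] is prime.
    Zorn's lemma is applied to sets [J] with [I `|` J] an ideal avoiding [S], for
    which the union of the empty chain is again such a set. *)
Lemma prime_avoiding I S : is_ideal I -> S 1 ->
    (forall p q, S p -> S q -> S (p * q)) -> (forall p, I p -> ~ S p) ->
  exists P, [/\ is_prime_ideal P, I `<=` P & forall p, P p -> ~ S p].
Proof.
move=> idI S1 SM IS.
pose good (J : set A) := is_ideal (I `|` J) /\ forall p, (I `|` J) p -> ~ S p.
have [J [[idJ JS] Jmax]] : exists J, good J /\ forall J', J `<` J' -> ~ good J'.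
  apply: Zorn_bigcup => F goodF totF; split; last first.
    move=> p [/IS //|[X FX Xp]]; have [_] := goodF _ FX.
    by apply; right.
  have [I0 ID IM] := idI.
  split; first by left.
    move=> p q [Ip|[X FX Xp]] [Iq|[Y FY Yq]]; first by left; apply: ID.
    - have [[_ D _] _] := goodF _ FY.
      by case: (D p q); [left|right|left|right; exists Y].
    - have [[_ D _] _] := goodF _ FX.
      by case: (D p q); [right|left|left|right; exists X].
    - wlog XY : p q X Y FX FY Xp Yq / X `<=` Y.
        move=> wl; have [XY|YX] := totF _ _ FX FY; first exact: (wl p q X Y).
        by rewrite addrC; apply: (wl q p Y X).
      have [[_ D _] _] := goodF _ FY.
      by case: (D p q); [right; apply: XY|right|left|right; exists Y].
  move=> a p [Ip|[X FX Xp]]; first by left; apply: IM.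
  have [[_ _ M] _] := goodF _ FX.
  by case: (M a p); [right|left|right; exists X].
set K := I `|` J in idJ JS; have [K0 KD KM] := idJ.
(* By maximality, the ideal generated by [K] and an element outside [K] meets [S]. *)
have meet x : ~ K x -> exists k a, K k /\ S (k + a * x).
  move=> Kx; pose L := [set z | exists k a, K k /\ z = k + a * x].
  have KL : K `<=` L by move=> z Kz; exists z, 0; rewrite mul0r addr0.
  apply: contrapT => noS; apply: (Jmax L).
    split; first by move=> z Jz; apply: KL; right.
    by move=> LJ; apply: Kx; right; apply: LJ; exists 0, 1; rewrite mul1r add0r.
  have IL : I `|` L = L by apply/setUidPr => z Iz; apply: KL; left.
  rewrite /good IL; split; last first.
    by move=> z [k [a [Kk ->]]] Sz; apply: noS; exists k, a.
  split; first exact: KL.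
    move=> y z [k [a [Kk ->]]] [l [b [Kl ->]]].
    by exists (k + l), (a + b); split; [apply: KD | ring].
  move=> b z [k [a [Kk ->]]].
  by exists (b * k), (b * a); split; [apply: KM | ring].
exists K; split=> //; last by move=> z Iz; left.
split=> // [/JS //|x y Kxy]; apply: contrapT => /not_orP [Kx Ky].
have [k [a [Kk Sk]]] := meet _ Kx; have [l [b [Kl Sl]]] := meet _ Ky.
apply: JS (SM _ _ Sk Sl).
have -> : (k + a * x) * (l + b * y) = (l + b * y) * k + (a * x) * l + (a * b) * (x * y) by ring.
by apply: (KD _ _ (KD _ _ _ _)); apply: KM.
Qed.

End IdealTheory.

Section ResidueField.
Variables (A : comNzRingType) (P : set A).
Hypothesis prP : is_prime_ideal P.

Definition prime_mem : {pred A} := fun p => `[< P p >].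

Lemma prime_memE p : (p \in prime_mem) = `[< P p >]. Proof. by []. Qed.

Fact prime_mem_idealr : idealr_closed prime_mem.
Proof.
have [[P0 PD PM] P1 _] := prP; split.
- by rewrite prime_memE; apply/asboolP.
- by rewrite prime_memE; apply/asboolPn.
- move=> a p q; rewrite !prime_memE => /asboolP Pp /asboolP Pq.
  by apply/asboolP; apply: PD => //; apply: PM.
Qed.

Fact prime_mem_prime : prime_idealr_closed prime_mem.
Proof.
have [_ _ PM] := prP => p q; rewrite !prime_memE => /asboolP /PM [] ?.
  by apply/orP; left; apply/asboolP.
by apply/orP; right; apply/asboolP.
Qed.

HB.instance Definition _ := isIdealr.Build A prime_mem prime_mem_idealr.
HB.instance Definition _ := isPrimeIdealrClosed.Build A prime_mem prime_mem_prime.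

Local Notation Q := {ideal_quot prime_mem}.

Definition quot_unit : {pred Q} := fun x => `[< exists y, y * x = 1 >].
Definition quot_inv (x : Q) : Q :=
  if pselect (exists y, y * x = 1) is left ex then projT1 (cid ex) else x.

Fact quot_mulVr : {in quot_unit, left_inverse 1 quot_inv *%R}.
Proof.
move=> x /asboolP ex; rewrite /quot_inv; case: pselect => // ex'.
by case: (cid ex').
Qed.

Fact quot_unitP (x y : Q) : y * x = 1 -> quot_unit x.
Proof. by move=> yx; apply/asboolP; exists y. Qed.

Fact quot_inv_out : {in [predC quot_unit], quot_inv =1 id}.
Proof.
by move=> x /asboolPn nx; rewrite /quot_inv; case: pselect.
Qed.

HB.instance Definition _ := GRing.ComNzRing_hasMulInverse.Build Q
  quot_mulVr quot_unitP quot_inv_out.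
HB.instance Definition _ := GRing.ComUnitRing_isIntegral.Build Q
  (@Quotient.rquot_IdomainAxiom A prime_mem).

(** The field is the fraction field of the quotient by [P]. *)
Lemma residue_field :
  exists (F : fieldType) (f : {rmorphism A -> F}), forall p, f p = 0 <-> P p.
Proof.
exists {fraction Q}, ((@tofrac Q) \o \pi_Q%qT) => p /=.
have -> : @tofrac Q (\pi_Q p)%qT = 0 <-> p \in prime_mem.
  rewrite (_ : (p \in prime_mem) = (\pi_Q p == 0)%qT).
    by split=> [/eqP|/eqP ->]; rewrite ?tofrac0 // tofrac_eq0.
  by rewrite -[in LHS](subr0 p) Quotient.idealrBE rmorph0.
by rewrite prime_memE; split=> /asboolP.
Qed.

End ResidueField.

(** * Algebraic independence and the height of primes *)

Lemma mpoly_ring_ind (R : comNzRingType) n (T : {mpoly R[n]} -> Prop) :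
    (forall c, T c%:MP) -> (forall i, T 'X_i) ->
    (forall p q, T p -> T q -> T (p + q)) ->
    (forall p q, T p -> T q -> T (p * q)) ->
  forall p, T p.
Proof.
move=> TC TX TD TM; elim/mpolyind => [|c m p _ _ Tp]; first by rewrite -mpolyC0.
apply: TD => //; rewrite -mul_mpolyC; apply: (TM) => //.
rewrite mpolyXE_id; elim/big_ind: _ => [||i _]; [by rewrite -mpolyC1 | exact: TM |].
by elim: (m i) => [|k IHk]; rewrite ?expr0 ?exprS -?mpolyC1 //; apply: TM.
Qed.

Section LastVariable.
Variables (R S : comNzRingType) (f : {rmorphism R -> S}) (n : nat).

(** The case analysis is the one by which [muni] singles out the last variable. *)
Definition snoc_fun (T : Type) (y : 'I_n -> T) (x : T) (i : 'I_n.+1) : T :=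
  match split (cast_ord (esym (addn1 n)) i) with inl j => y j | inr _ => x end.

Lemma mmap_muni (y : 'I_n -> S) (x : S) q :
  mmap f (snoc_fun y x) q = (map_poly (mmap f y) (muni q)).[x].
Proof.
elim/mpoly_ring_ind: q => [c|i|p q IHp IHq|p q IHp IHq].
- by rewrite mmapC muniC map_polyC hornerC /= mmapC.
- rewrite mmapX mmap1U /muni mmapX mmap1U /snoc_fun.
  by case: split => j; rewrite ?map_polyX ?hornerX // map_polyC hornerC /= mmapX mmap1U.
- by rewrite muniD !rmorphD /= hornerD IHp IHq.
- by rewrite muniM !rmorphM /= hornerM IHp IHq.
Qed.
End LastVariable.

(** Evaluating the coefficients of [muni q] and its variable at the original
    variables gives back [q]. *)
Lemma muni_eq0 (R : comNzRingType) n (q : {mpoly R[n.+1]}) : muni q = 0 -> q = 0.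
Proof.
pose lift := fun i : 'I_n => 'X_(widen_ord (leqnSn n) i) : {mpoly R[n.+1]}.
have : mmap (@mpolyC n.+1 R) (snoc_fun lift 'X_ord_max) q = q.
  elim/mpoly_ring_ind: q => [c|i|p q IHp IHq|p q IHp IHq].
  - by rewrite mmapC.
  - rewrite mmapX mmap1U /snoc_fun; case: splitP => [j|j] /= ij.
      by congr 'X__; apply: val_inj.
    by congr 'X__; apply: val_inj; rewrite /= ij ord1 addn0.
  - by rewrite rmorphD /= IHp IHq.
  - by rewrite rmorphM /= IHp IHq.
by rewrite mmap_muni => qE mq0; rewrite -qE mq0 rmorph0 horner0.
Qed.

Section Transcendence.
Variables (K : fieldType) (n : nat).
Local Notation A := {mpoly K[n]}.

Definition alg_indep_mod (P : set A) d (y : 'I_d -> A) : Prop :=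
  forall q : {mpoly K[d]}, P (mmap (@mpolyC n K) y q) -> q = 0.

(** Given a relation of [x] over [y] modulo [Q], its constant term is a relation
    of [y] modulo [P], since [x] lies in [P]; so that term vanishes, and a factor
    [x], which is not in the prime [Q], can be cancelled from the relation. *)
Lemma alg_indep_snoc (P Q : set A) d (y : 'I_d -> A) x :
    is_ideal P -> is_prime_ideal Q -> Q `<=` P -> P x -> ~ Q x ->
  alg_indep_mod P y -> alg_indep_mod Q (snoc_fun y x).
Proof.
move=> [P0 PD PM] [_ _ primeQ] QP Px nQx indy q.
rewrite mmap_muni => Qq; apply: muni_eq0; apply/eqP; apply: contrapT.
move=> /negP; move: (muni q) Qq => {q}.
elim/poly_ind => [|r c IHr]; first by rewrite eqxx.
rewrite rmorphD rmorphM /= map_polyX map_polyC !hornerE /= => Qrc.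
have /indy c0 : P (mmap (@mpolyC n K) y c).
  have /QP Prc := Qrc.
  rewrite -[mmap _ _ _](addKr ((map_poly (mmap (@mpolyC n K) y) r).[x] * x)).
  apply: PD => //; rewrite -mulNr; exact: PM.
move: Qrc; rewrite c0 rmorph0 addr0 => /primeQ [Qr|//].
by rewrite polyC0 addr0 mulf_eq0 negb_or => /andP[/(IHr Qr)].
Qed.

(** At the bottom of the chain, independence modulo a prime gives independence
    in the polynomial ring itself. *)
Lemma alg_indep_height (P : set A) h d (y : 'I_d -> A) :
    height_ge P h -> alg_indep_mod P y ->
  exists z : 'I_(h + d) -> A, forall q, mmap (@mpolyC n K) z q = 0 -> q = 0.
Proof.
move=> [Q [primeQ strictQ <-]] indy.
have descend j : (j <= h)%N ->
    exists z : 'I_(j + d) -> A, alg_indep_mod (Q (h - j)%N) z.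
  elim: j => [_|j IHj ltjh]; first by exists y; rewrite subn0.
  have [z indz] := IHj (ltnW ltjh).
  have hjS : (h - j = (h - j.+1).+1)%N by rewrite -subSn.
  have [sub /existsNP [x /not_implyP [Qx nQx]]] : Q (h - j.+1)%N `<` Q (h - j)%N.
    by rewrite hjS; apply: strictQ; rewrite -hjS leq_subr.
  exists (snoc_fun z x); apply: (@alg_indep_snoc (Q (h - j)%N)) => //.
    by have [] := primeQ _ (leq_subr j h).
  by apply: primeQ; apply: leq_subr.
have [z indz] := descend h (leqnn h); exists z => q q0; apply: indz.
rewrite q0 subnn; by have [[]] := primeQ 0 (leq0n h).
Qed.

Definition mdeg_bounded (k : nat) (p : A) := forall m, m \in msupp p -> (mdeg m <= k)%N.

Lemma mdeg_boundedM k l p q :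
  mdeg_bounded k p -> mdeg_bounded l q -> mdeg_bounded (k + l) (p * q).
Proof.
move=> kp lq m /msuppM_le /allpairsP [[m1 m2] /= [m1p m2q ->]].
by rewrite mdegD leq_add ?kp ?lq.
Qed.

Lemma mdeg_bounded_mmap1 m B (z : 'I_m -> A) (e : 'X_{1..m}) :
    (forall i, mdeg_bounded B (z i)) ->
  mdeg_bounded (\sum_(i < m) e i * B) (mmap1 z e).
Proof.
move=> zB; rewrite /mmap1; elim/big_ind2: _ => [|k p l q|i _].
- by move=> k; rewrite msupp1 inE => /eqP ->; rewrite mdeg0.
- exact: mdeg_boundedM.
- elim: (e i) => [k|k IHk].
    by rewrite expr0 msupp1 inE => /eqP ->; rewrite mdeg0.
  by rewrite exprS mulSn; apply: mdeg_boundedM.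
Qed.

(** By counting dimensions: the [N ^ m] monomials in [z] with exponents below [N]
    have degree linear in [N], so they lie in a space whose dimension grows like
    [N ^ n]; as [n < m], they are linearly dependent for large [N]. *)
Lemma alg_dependent m (z : 'I_m -> A) : (n < m)%N ->
  exists2 q : {mpoly K[m]}, q != 0 & mmap (@mpolyC n K) z q = 0.
Proof.
move=> ltnm; pose B := (\max_(i < m) msize (z i))%N.
have zB i : mdeg_bounded B (z i).
  by move=> e /msize_mdeg_lt /ltnW/leq_trans; apply; apply: leq_bigmax.
(* [L ^ n < N ^ m] follows from [L <= N * (m * B + 1)] and
   [(m * B + 1) ^ n < N]. *)
pose N := ((m * B + 1) ^ n).+1; pose L := (m * (N * B) + 1)%N.
have card_lt : (#|{ffun 'I_n -> 'I_L}| < #|{ffun 'I_m -> 'I_N}|)%N.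
  rewrite !card_ffun !card_ord.
  have LN : (L <= N * (m * B + 1))%N.
    by rewrite /L mulnDr muln1 mulnCA leq_add2l.
  apply: leq_ltn_trans (_ : (N * (m * B + 1)) ^ n < _)%N; first by case: (n) => // k; rewrite leq_exp2r.
  rewrite expnMn; apply: leq_trans (_ : N ^ n.+1 <= _)%N; last by rewrite leq_pexp2l.
  by rewrite expnSr ltn_mul2l expn_gt0 /=.
pose mono k l (e : {ffun 'I_k -> 'I_l}) := [multinom (e i : nat) | i < k].
have mono_inj k l : injective (@mono k l).
  move=> e e' /mnmP ee'; apply/ffunP => i; apply: val_inj.
  by have := ee' i; rewrite !mnmE.
pose w (e : {ffun 'I_m -> 'I_N}) := mmap1 z (mono _ _ e).
have wB e : mdeg_bounded (m * (N * B)) (w e).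
  move=> g /(mdeg_bounded_mmap1 zB) /leq_trans; apply.
  rewrite -[m in (m * _)%N]card_ord -sum_nat_const leq_sum // => i _.
  by rewrite mnmE leq_mul2r ltnW ?orbT.
pose M : 'M[K]_(#|{ffun 'I_m -> 'I_N}|, #|{ffun 'I_n -> 'I_L}|) :=
  \matrix_(i, j) (w (enum_val i))@_(mono _ _ (enum_val j)).
have [v v_neq0 vM] : exists2 v : 'rV_#|{ffun 'I_m -> 'I_N}|, v != 0 & v *m M = 0.
  have : kermx M != 0.
    by rewrite kermx_eq0 /row_free neq_ltn (leq_ltn_trans (rank_leq_col M) card_lt).
  move=> /rowV0Pn [v vk v0]; exists v => //; exact/sub_kermxP.
pose q : {mpoly K[m]} := \sum_i v 0 i *: 'X_[mono _ _ (enum_val i)].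
exists q.
  apply: contra v_neq0 => /eqP q0; apply/eqP/rowP => i; rewrite mxE.
  have := congr1 (mcoeff (mono _ _ (enum_val i))) q0.
  rewrite mcoeff0 raddf_sum /= (bigD1 i) //= big1 => [|j ji].
    by rewrite mcoeffZ mcoeffX eqxx mulr1 addr0.
  rewrite mcoeffZ mcoeffX (inj_eq (mono_inj _ _)) (inj_eq enum_val_inj).
  by rewrite (negPf ji) mulr0.
apply/mpolyP => g; rewrite mcoeff0 /q (raddf_sum (mmap _ _)) (raddf_sum (mcoeff g)) /=.
under eq_bigr => i _ do rewrite mmapZ mmapX mcoeffCM -/(w _).
(* A coefficient of high degree vanishes by [wB], any other one by [vM]. *)
have [gL|] := leqP (mdeg g) (m * (N * B)); last first.
  move=> gL; apply: big1 => i _; rewrite (memN_msupp_eq0 (m:=g)) ?mulr0 //.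
  by apply/negP => /wB; rewrite leqNgt gL.
have gi i : (g i < L)%N.
  by rewrite /L addn1 ltnS (leq_trans _ gL) // mdegE (bigD1 i) //= leq_addr.
have gE : g = mono _ _ (enum_val (enum_rank [ffun i => Ordinal (gi i)])).
  by apply/mnmP => i; rewrite enum_rankK mnmE ffunE.
have /rowP/(_ (enum_rank [ffun i => Ordinal (gi i)])) := vM.
rewrite !mxE => vMg; rewrite -[RHS]vMg; apply: eq_bigr => i _.
by rewrite [in LHS]gE mxE.
Qed.

Lemma height_trdeg (P : set A) h d (y : 'I_d -> A) :
  height_ge P h -> alg_indep_mod P y -> (h + d <= n)%N.
Proof.
move=> hP /(alg_indep_height hP) [z indz].
rewrite leqNgt; apply/negP => /(alg_dependent z) [q q0 /indz q0'].
by rewrite q0' eqxx in q0.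
Qed.
End Transcendence.

Lemma mpoly_nonvanishing (K : fieldType) n (q : {mpoly K[n]}) :
    (forall k, k.+1%:R != 0 :> K) ->
  q != 0 -> exists v, q.@[v] != 0.
Proof.
move=> K_char0; elim: n q => [|n IHn] q q0.
  exists (fun=> 0); move: q0; rewrite [q](@msize1_polyC _ _ q) ?mevalC ?mpolyC_eq0 //.
  rewrite msizeE; apply/bigmax_leqP_seq => m _ _.
  by rewrite mdegE big_ord0.
have [j qj] : (exists i, (muni q)`_i != 0).
  apply: contrapT => /forallNP q_0; move/eqP: q0; apply; apply: muni_eq0.
  by apply/polyP => i; rewrite coef0; apply/eqP; apply: contrapT => /negP /q_0.
have [v qv] := IHn _ qj; pose p := map_poly (meval v) (muni q).
have p0 : p != 0.
  by apply: contra qv => /eqP p0; rewrite -coef_map /= -/p p0 coef0.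
have [k pk] : (exists k : nat, ~~ root p k%:R).
  apply: contrapT => /forallNP allroots.
  pose rs : seq K := [seq k%:R | k <- iota 0 (size p)].
  have : (size rs < size p)%N.
    apply: max_poly_roots => //.
      by apply/allP => _ /mapP [k _ ->]; apply/negbNE/negP/allroots.
    rewrite map_inj_uniq ?iota_uniq // => k l kl.
    wlog ltkl : k l kl / (k < l)%N.
      by move=> wl; have [/wl|/wl|//] := ltngtP k l; move=> ->.
    have := K_char0 (l - k.+1)%N; rewrite subnSK // natrB ?kl ?subrr ?eqxx //.
    exact: ltnW.
  by rewrite size_map size_iota ltnn.
by exists (snoc_fun v k%:R); rewrite /meval mmap_muni.
Qed.

(** * Chains of primes below the ideal of the variety *)

(** If, modulo [P] and up to powers of [s], every variable agrees with an element
    on which [emb] takes the value that [ev] takes on the variable, then so does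
    every polynomial [p].  When [ev p = 0] that element is [0] as [emb] is
    injective, hence [P] contains a product of [p] and a power of [s]. *)
Lemma prime_sub_kernel (K : fieldType) n (D : idomainType)
    (emb ev : {rmorphism {mpoly K[n]} -> D}) (P : set {mpoly K[n]}) s :
    is_prime_ideal P -> ~ P s -> injective emb -> ev s = emb s ->
    (forall c, ev c%:MP = emb c%:MP) ->
    (forall i, exists N r, emb r = ev (s ^+ N * 'X_i) /\ P (s ^+ N * 'X_i - r)) ->
  forall p, ev p = 0 -> P p.
Proof.
move=> primeP nPs inj_emb ev_s evC evX p.
have [[P0 PD PM] _ primePM] := primeP.
suff [N [r [rE Pr]]] : exists N r, emb r = ev (s ^+ N * p) /\ P (s ^+ N * p - r).
  move=> evp; have r0 : r = 0.
    by apply: inj_emb; rewrite rE rmorphM evp mulr0 rmorph0.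
  move: Pr; rewrite r0 subr0 => /primePM [|//] /(prime_idealX primeP) //.
elim/mpoly_ring_ind: p => [c|//|p q [N [r [rE Pr]]] [M [t [tE Pt]]]|p q [N [r [rE Pr]]] [M [t [tE Pt]]]].
- by exists 0%N, c%:MP; rewrite expr0 mul1r evC subrr.
- exists (N + M)%N, (s ^+ M * r + s ^+ N * t); split.
    rewrite exprD mulrDr !(rmorphD, rmorphM) /= rE tE !rmorphM /= !rmorphXn /= ev_s.
    by ring.
  have -> : s ^+ (N + M) * (p + q) - (s ^+ M * r + s ^+ N * t)
      = s ^+ M * (s ^+ N * p - r) + s ^+ N * (s ^+ M * q - t).
    by rewrite exprD; ring.
  by apply: PD; apply: PM.
- exists (N + M)%N, (r * t); split.
    by rewrite exprD rmorphM rE tE -rmorphM; congr (ev _); ring.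
  have -> : s ^+ (N + M) * (p * q) - r * t
      = (s ^+ M * q) * (s ^+ N * p - r) + r * (s ^+ M * q - t).
    by rewrite exprD; ring.
  by apply: PD; apply: PM.
Qed.

Lemma ord8_ind (T : 'I_8 -> Prop) :
    T (@Ordinal 8 0 isT) -> T (@Ordinal 8 1 isT) -> T (@Ordinal 8 2 isT) ->
    T (@Ordinal 8 3 isT) -> T (@Ordinal 8 4 isT) -> T (@Ordinal 8 5 isT) ->
    T (@Ordinal 8 6 isT) -> T (@Ordinal 8 7 isT) -> forall i, T i.
Proof.
move=> T0 T1 T2 T3 T4 T5 T6 T7 [[|[|[|[|[|[|[|[|i]]]]]]]] lti] //;
  by rewrite (bool_irrelevance lti isT).
Qed.

Section Morphism.
Variables (K : fieldType) (S : comNzRingType) (f : {rmorphism {mpoly K[8]} -> S}).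

Lemma us_morph : f (us K) = f (t1 K) + f (t2 K)
  - (f (x3 K) * f (x12 K) + f (x2 K) * f (x13 K) + f (x1 K) * f (x23 K)
     - f (x1 K) * f (x2 K) * f (x3 K)).
Proof. by rewrite /us !(rmorphB, rmorphD, rmorphM). Qed.

Lemma u2_morph : f (u2 K) = 4%:R - f (x1 K) ^+ 2 - f (x2 K) ^+ 2 - f (x3 K) ^+ 2
  - f (x1 K) * f (x2 K) * f (x3 K) * f (t1 K) - f (t1 K) ^+ 2
  + f (x1 K) * f (x2 K) * f (x12 K) + f (x3 K) * f (t1 K) * f (x12 K) - f (x12 K) ^+ 2
  + f (x1 K) * f (x3 K) * f (x13 K) + f (x2 K) * f (t1 K) * f (x13 K) - f (x13 K) ^+ 2
  + f (x2 K) * f (x3 K) * f (x23 K) + f (x1 K) * f (t1 K) * f (x23 K)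
  - f (x12 K) * f (x13 K) * f (x23 K) - f (x23 K) ^+ 2.
Proof. by rewrite /u2 !(rmorphB, rmorphD, rmorphM, rmorph1) /=; ring. Qed.
End Morphism.

(** Solving [us = 0] for [x12], which occurs with coefficient [x3]. *)
Fact us_solved (F : fieldType) (a b c p q u v : F) : c != 0 ->
  u + v - (c * ((u + v - b * q - a * p + a * b * c) / c) + b * q + a * p
           - a * b * c) = 0.
Proof. by move=> c0; rewrite [c * _]mulrC divfK //; ring. Qed.

Section LowerBound.
Variables (K : fieldType) (b1 b2 : K).
Local Notation A := {mpoly K[8]}.
Local Notation x1 := (x1 K). Local Notation x2 := (x2 K). Local Notation x3 := (x3 K).
Local Notation x12 := (x12 K). Local Notation x13 := (x13 K).
Local Notation x23 := (x23 K). Local Notation t1 := (t1 K). Local Notation t2 := (t2 K).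
Local Notation us := (us K). Local Notation u2 := (u2 K).
Local Notation emb := (@tofrac A).

Definition frac_eval (s : seq {fraction A}) : {rmorphism A -> {fraction A}} :=
  mmap (emb \o @mpolyC 8 K) (fun i : 'I_8 => s`_i).

Lemma frac_evalX s (i : 'I_8) : frac_eval s 'X_i = s`_i.
Proof. by rewrite /frac_eval /= mmapX mmap1U. Qed.

Lemma frac_evalC s c : frac_eval s c%:MP = emb c%:MP.
Proof. by rewrite /frac_eval /= mmapC. Qed.

Lemma emb_inj : injective emb.
Proof. by move=> p q /eqP; rewrite tofrac_eq => /eqP. Qed.

(** The primes of the chain are the kernels of the evaluations at the generic
    points of [t1 = b1], of [t1 = b1, t2 = b2], and of the hypersurfaces [us = 0]
    and [x3 = 0] in the latter; as kernels of maps to a field they are prime. *)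
Definition sol_t1 := frac_eval
  [:: emb x1; emb x2; emb x3; emb x12; emb x13; emb x23; emb b1%:MP; emb t2].
Definition sol_t := frac_eval
  [:: emb x1; emb x2; emb x3; emb x12; emb x13; emb x23; emb b1%:MP; emb b2%:MP].
Definition sol_x12_num : A := b1%:MP + b2%:MP - x2 * x13 - x1 * x23 + x1 * x2 * x3.
Definition sol_x12 := frac_eval
  [:: emb x1; emb x2; emb x3; emb sol_x12_num / emb x3; emb x13; emb x23; emb b1%:MP; emb b2%:MP].
Definition sol_x3 := frac_eval
  [:: emb x1; emb x2; 0; emb x12; emb x13; emb x23; emb b1%:MP; emb b2%:MP].

Fact clear_var (f : {rmorphism A -> {fraction A}}) (P : set A) s i r :
    P ('X_i - r) -> f 'X_i = emb r ->
  exists N r, emb r = f (s ^+ N * 'X_i) /\ P (s ^+ N * 'X_i - r).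
Proof. by move=> Pr fr; exists 0%N, r; rewrite expr0 mul1r. Qed.

Fact fixed_var (f : {rmorphism A -> {fraction A}}) (P : set A) s i :
    is_ideal P -> f 'X_i = emb 'X_i ->
  exists N r, emb r = f (s ^+ N * 'X_i) /\ P (s ^+ N * 'X_i - r).
Proof. by move=> [P0 _ _]; apply: clear_var; rewrite subrr. Qed.

Lemma subset_sol_t1 P : is_prime_ideal P -> P (t1 - b1%:MP) ->
  [set p | sol_t1 p = 0] `<=` P.
Proof.
move=> primeP Pt1; have [idP P1 _] := primeP.
apply: (prime_sub_kernel primeP P1 emb_inj); [by rewrite !rmorph1|exact: frac_evalC|].
apply: ord8_ind; try by apply: fixed_var; rewrite ?frac_evalX.
by apply: clear_var Pt1 _; rewrite frac_evalX.
Qed.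

Lemma subset_sol_t P : is_prime_ideal P -> P (t1 - b1%:MP) -> P (t2 - b2%:MP) ->
  [set p | sol_t p = 0] `<=` P.
Proof.
move=> primeP Pt1 Pt2; have [idP P1 _] := primeP.
apply: (prime_sub_kernel primeP P1 emb_inj); [by rewrite !rmorph1|exact: frac_evalC|].
apply: ord8_ind; try by apply: fixed_var; rewrite ?frac_evalX.
- by apply: clear_var Pt1 _; rewrite frac_evalX.
- by apply: clear_var Pt2 _; rewrite frac_evalX.
Qed.

Lemma subset_sol_x3 P : is_prime_ideal P -> P (t1 - b1%:MP) -> P (t2 - b2%:MP) ->
  P x3 -> [set p | sol_x3 p = 0] `<=` P.
Proof.
move=> primeP Pt1 Pt2 Px3; have [idP P1 _] := primeP.
apply: (prime_sub_kernel primeP P1 emb_inj); [by rewrite !rmorph1|exact: frac_evalC|].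
apply: ord8_ind; try by apply: fixed_var; rewrite ?frac_evalX.
- by exists 0%N, 0; rewrite expr0 mul1r subr0 rmorph0 frac_evalX.
- by apply: clear_var Pt1 _; rewrite frac_evalX.
- by apply: clear_var Pt2 _; rewrite frac_evalX.
Qed.

Lemma emb_x3_neq0 : emb x3 != 0.
Proof.
rewrite tofrac_eq0; apply/eqP => /(congr1 (meval (fun=> 1))).
by rewrite mevalXU meval0 => /eqP; rewrite oner_eq0.
Qed.

Lemma subset_sol_x12 P : is_prime_ideal P -> P (t1 - b1%:MP) -> P (t2 - b2%:MP) ->
  P us -> ~ P x3 -> [set p | sol_x12 p = 0] `<=` P.
Proof.
move=> primeP Pt1 Pt2 Pus nPx3; have [idP _ _] := primeP.
apply: (prime_sub_kernel primeP nPx3 emb_inj); [by rewrite frac_evalX|exact: frac_evalC|].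
apply: ord8_ind; try by apply: fixed_var; rewrite ?frac_evalX.
- exists 1%N, sol_x12_num; rewrite expr1 rmorphM !frac_evalX /=; split.
    by rewrite mulrC divfK // emb_x3_neq0.
  have [_ PD PM] := idP.
  rewrite (_ : _ - _ = (t1 - b1%:MP) + (t2 - b2%:MP) + (-1) * us).
    by apply: (PD); [apply: PD | apply: PM].
  by rewrite /sol_x12_num /Defs.us -/x12; ring.
- by apply: clear_var Pt1 _; rewrite frac_evalX.
- by apply: clear_var Pt2 _; rewrite frac_evalX.
Qed.

Definition evpt (s : seq K) : A -> K := meval (fun i : 'I_8 => s`_i).
HB.instance Definition _ s := GRing.RMorphism.on (evpt s).

Lemma evptX s (i : 'I_8) : evpt s 'X_i = s`_i. Proof. exact: mevalXU. Qed.
Lemma evptC s c : evpt s c%:MP = c. Proof. exact: mevalC. Qed.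

Lemma evpt_t1 s c : evpt s (t1 - c%:MP) = s`_6 - c.
Proof. by rewrite rmorphB /= evptC evptX. Qed.

Lemma evpt_t2 s c : evpt s (t2 - c%:MP) = s`_7 - c.
Proof. by rewrite rmorphB /= evptC evptX. Qed.

Lemma evpt_x3 s : evpt s x3 = s`_2.
Proof. exact: evptX. Qed.

Lemma evpt_us s : evpt s us = s`_6 + s`_7
  - (s`_2 * s`_3 + s`_1 * s`_4 + s`_0 * s`_5 - s`_0 * s`_1 * s`_2).
Proof. by rewrite us_morph /= !evptX. Qed.

Lemma evpt_u2 s : evpt s u2 = 4%:R - s`_0 ^+ 2 - s`_1 ^+ 2 - s`_2 ^+ 2
  - s`_0 * s`_1 * s`_2 * s`_6 - s`_6 ^+ 2
  + s`_0 * s`_1 * s`_3 + s`_2 * s`_6 * s`_3 - s`_3 ^+ 2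
  + s`_0 * s`_2 * s`_4 + s`_1 * s`_6 * s`_4 - s`_4 ^+ 2
  + s`_1 * s`_2 * s`_5 + s`_0 * s`_6 * s`_5 - s`_3 * s`_4 * s`_5 - s`_5 ^+ 2.
Proof. by rewrite u2_morph /= !evptX. Qed.

Lemma prime_evpt s : is_prime_ideal [set p | evpt s p = 0].
Proof. exact: prime_ideal_kernel. Qed.

Lemma prime_frac (f : {rmorphism A -> {fraction A}}) : is_prime_ideal [set p | f p = 0].
Proof. exact: prime_ideal_kernel. Qed.

Lemma frac_eval_t1 u0 u1 u2 u3 u4 u5 s :
  frac_eval [:: u0, u1, u2, u3, u4, u5, emb b1%:MP & s] (t1 - b1%:MP) = 0.
Proof. by rewrite rmorphB frac_evalC frac_evalX subrr. Qed.

Lemma frac_eval_t2 u0 u1 u2 u3 u4 u5 u6 s :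
  frac_eval [:: u0, u1, u2, u3, u4, u5, u6, emb b2%:MP & s] (t2 - b2%:MP) = 0.
Proof. by rewrite rmorphB frac_evalC frac_evalX subrr. Qed.

(** Each inclusion of the chain is shown to be strict at a point of the larger
    locus that does not satisfy the equation of the smaller one. *)
Lemma proper_sol_t1 : [set p | emb p = 0] `<` [set p | sol_t1 p = 0].
Proof.
split=> [p /= /eqP|/(_ (t1 - b1%:MP))]; first by rewrite tofrac_eq0 => /eqP ->; exact: rmorph0.
move=> /(_ (frac_eval_t1 _ _ _ _ _ _ _)) /= /eqP; rewrite tofrac_eq0 => /eqP.
move=> /(congr1 (evpt [:: 0; 0; 0; 0; 0; 0; b1 + 1; 0])).
rewrite evpt_t1 (rmorph0 (evpt _)) /= addrAC subrr add0r => /eqP.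
by rewrite oner_eq0.
Qed.

Lemma proper_sol_t : [set p | sol_t1 p = 0] `<` [set p | sol_t p = 0].
Proof.
split; first exact: (subset_sol_t1 (prime_frac sol_t) (frac_eval_t1 _ _ _ _ _ _ _)).
move=> /(_ _ (frac_eval_t2 _ _ _ _ _ _ _ _)).
move=> /(subset_sol_t1 (prime_evpt [:: 0; 0; 0; 0; 0; 0; b1; b2 + 1])) /=.
rewrite evpt_t1 evpt_t2 /= subrr => /(_ erefl) /eqP.
by rewrite addrAC subrr add0r oner_eq0.
Qed.

Lemma proper_sol_x3 : [set p | sol_t p = 0] `<` [set p | sol_x3 p = 0].
Proof.
split; first exact: (subset_sol_t (prime_frac sol_x3) (frac_eval_t1 _ _ _ _ _ _ _) (frac_eval_t2 _ _ _ _ _ _ _ _)).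
move=> /(_ x3 (frac_evalX _ (@Ordinal 8 2 isT))).
move=> /(subset_sol_t (prime_evpt [:: 0; 0; 1; 0; 0; 0; b1; b2])) /=.
rewrite evpt_t1 evpt_t2 evpt_x3 /= !subrr => /(_ erefl erefl) /eqP.
by rewrite oner_eq0.
Qed.

Lemma proper_sol_x3_prime P : is_prime_ideal P -> P (t1 - b1%:MP) ->
  P (t2 - b2%:MP) -> P x3 -> P us -> [set p | sol_x3 p = 0] `<` P.
Proof.
move=> primeP Pt1 Pt2 Px3 Pus; split; first exact: subset_sol_x3.
move=> /(_ us Pus).
move=> /(subset_sol_x3 (prime_evpt [:: 0; 1; 0; 0; b1 + b2 + 1; 0; b1; b2])) /=.
rewrite evpt_t1 evpt_t2 evpt_x3 evpt_us /= !subrr => /(_ erefl erefl erefl) /eqP.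
by rewrite (_ : _ - _ = -1) ?oppr_eq0 ?oner_eq0 //; ring.
Qed.

Lemma sol_x12_us : sol_x12 us = 0.
Proof.
rewrite us_morph !frac_evalX /= /sol_x12_num !(tofracB, tofracD, tofracM).
exact: us_solved emb_x3_neq0.
Qed.

Lemma proper_sol_x12 : [set p | sol_t p = 0] `<` [set p | sol_x12 p = 0].
Proof.
split; first exact: (subset_sol_t (prime_frac sol_x12) (frac_eval_t1 _ _ _ _ _ _ _) (frac_eval_t2 _ _ _ _ _ _ _ _)).
move=> /(_ _ sol_x12_us).
move=> /(subset_sol_t (prime_evpt [:: 0; 1; 0; 0; b1 + b2 + 1; 0; b1; b2])) /=.
rewrite evpt_t1 evpt_t2 evpt_us /= !subrr => /(_ erefl erefl) /eqP.
by rewrite (_ : _ - _ = -1) ?oppr_eq0 ?oner_eq0 //; ring.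
Qed.

Lemma proper_sol_x12_prime P : is_prime_ideal P -> P (t1 - b1%:MP) ->
  P (t2 - b2%:MP) -> P us -> ~ P x3 -> P u2 -> [set p | sol_x12 p = 0] `<` P.
Proof.
move=> primeP Pt1 Pt2 Pus nPx3 Pu2; split; first exact: subset_sol_x12.
(* At this point [us = 0] and [u2 = e - y ^ 2], which cannot vanish for both
   [y = 0] and [y = 1]. *)
pose e : K := 4%:R - 1 - b1 ^+ 2 + b1 * (b1 + b2) - (b1 + b2) ^+ 2.
have [y y0] : exists y, e - y ^+ 2 != 0.
  have [e0|] := eqVneq e 0.
    by exists 1; rewrite e0 sub0r oppr_eq0 expr1n oner_eq0.
  by exists 0; rewrite expr0n subr0.
move=> /(_ u2 Pu2).
move=> /(subset_sol_x12 (prime_evpt [:: 0; 0; 1; b1 + b2; 0; y; b1; b2])) /=.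
rewrite evpt_t1 evpt_t2 evpt_x3 evpt_us evpt_u2 /= !subrr => /(_ erefl erefl) u2_eq0.
move/eqP: y0; apply; rewrite -u2_eq0 /e; first by ring.
  by ring.
by apply/eqP; rewrite oner_eq0.
Qed.

Lemma rel_rep_height_ge (P : set A) : is_prime_ideal P ->
  generated_ideal (rel_rep_gens b1 b2) `<=` P -> height_ge P 4.
Proof.
move=> primeP IP.
have gen i : P (tnth (rel_rep_gens b1 b2) i).
  by apply: IP; apply: sub_ideal_gen => /=; apply: mem_tnth.
have Pt1 := gen (@Ordinal 4 0 isT); have Pt2 := gen (@Ordinal 4 1 isT).
have Pu2 := gen (@Ordinal 4 2 isT); have Pus := gen (@Ordinal 4 3 isT).
rewrite /tnth /= in Pt1 Pt2 Pu2 Pus.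
have chain (Q3 : set A) : is_prime_ideal Q3 -> [set p | sol_t p = 0] `<` Q3 ->
    Q3 `<` P -> height_ge P 4.
  have := (prime_frac emb, prime_frac sol_t1, prime_frac sol_t).
  have := (proper_sol_t1, proper_sol_t).
  move: [set p | emb p = 0] [set p | sol_t1 p = 0] [set p | sol_t p = 0].
  move=> Q0 Q1 Q2 [Q01 Q12] [[pr0 pr1] pr2] pr3 Q23 Q3P.
  exists (nth P [:: Q0; Q1; Q2; Q3]).
  by split=> // [[|[|[|[|[|i]]]]]|[|[|[|[|i]]]]].
have [Px3|nPx3] := pselect (P x3).
  exact: chain (prime_frac sol_x3) proper_sol_x3 (proper_sol_x3_prime _ _ _ _ _).
exact: chain (prime_frac sol_x12) proper_sol_x12 (proper_sol_x12_prime _ _ _ _ _ _).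
Qed.
End LowerBound.

(** * The ideal of the variety has codimension four *)

Section Locus.
Variables (K : fieldType) (b1 b2 : K).
Hypothesis K_char0 : forall n, n.+1%:R != 0 :> K.
Hypothesis K_sqrt : forall x : K, exists y, y ^+ 2 = x.
Local Notation A := {mpoly K[8]}.
Local Notation I := (generated_ideal (rel_rep_gens b1 b2)).

Lemma rel_rep_ideal_point s :
    evpt s (t1 K - b1%:MP) = 0 -> evpt s (t2 K - b2%:MP) = 0 ->
    evpt s (u2 K) = 0 -> evpt s (us K) = 0 ->
  I `<=` [set p | evpt s p = 0].
Proof.
move=> s1 s2 s3 s4; have [idV _ _] := prime_evpt s.
apply: ideal_gen_min => // p /=; rewrite !inE.
by move=> /or4P [] /eqP ->.
Qed.

Lemma quadratic_root (a b c : K) : a != 0 -> exists z, c + b * z - a * z ^+ 2 = 0.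
Proof.
move=> a0; have a2 : 2%:R * a != 0 by rewrite mulf_neq0 // K_char0.
have [d dE] := K_sqrt (b ^+ 2 + 4%:R * a * c).
exists ((b + d) / (2%:R * a)).
have -> : c = (d ^+ 2 - b ^+ 2) / (4%:R * a).
  by rewrite dE; field; rewrite a0 K_char0.
by field; rewrite a0 !K_char0.
Qed.

(** Substituting the solution [x12] of [us = 0] in [u2] and multiplying by
    [x3 ^ 2] gives [const + lin * x23 - lead * x23 ^ 2], where [lead] is the
    quantity assumed nonzero. *)
Lemma fiber_nonempty (a b c q : K) : c != 0 -> a ^+ 2 - a * c * q + c ^+ 2 != 0 ->
  exists r p, I `<=` [set f | evpt [:: a; b; c; r; q; p; b1; b2] f = 0].
Proof.
move=> c0 lead0.
pose w := b1 + b2 - b * q + a * b * c.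
pose const := c ^+ 2 * (4%:R - a ^+ 2 - b ^+ 2 - c ^+ 2 - a * b * c * b1 - b1 ^+ 2
  + a * c * q + b * b1 * q - q ^+ 2) + c * w * (a * b + c * b1) - w ^+ 2.
pose lin := - a * c * (a * b + c * b1) + 2%:R * a * w + c ^+ 2 * (b * c + a * b1)
  - c * q * w.
have [p pE] := quadratic_root lin const lead0.
exists ((w - a * p) / c), p; apply: rel_rep_ideal_point.
- by rewrite evpt_t1 subrr.
- by rewrite evpt_t2 subrr.
- rewrite evpt_u2 /=; apply: (mulfI (expf_neq0 2 c0)); rewrite mulr0 -pE /const /lin /w.
  by field.
- by rewrite evpt_us /= /w; field.
Qed.

Definition base_coords (i : 'I_4) : A := nth 0 [:: x1 K; x2 K; x3 K; x13 K] i.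

Lemma evpt_base_coords s (q : {mpoly K[4]}) :
  evpt s (mmap (@mpolyC 8 K) base_coords q) =
  q.@[fun i : 'I_4 => nth 0 [:: s`_0; s`_1; s`_2; s`_4] i].
Proof.
elim/mpoly_ring_ind: q => [c|i|p q IHp IHq|p q IHp IHq].
- by rewrite mmapC evptC mevalC.
- rewrite mmapX mmap1U mevalXU /base_coords.
  by case: i => [[|[|[|[|i]]]] lti] //=; rewrite evptX.
- by rewrite !rmorphD /= IHp IHq.
- by rewrite !rmorphM /= IHp IHq.
Qed.

(** A polynomial in the base coordinates that belongs to the ideal vanishes
    wherever the fibre is nonempty, that is off the zeros of a fixed nonzero
    polynomial, and is therefore zero.  So the ideal avoids the multiplicative
    set of nonzero polynomials in these coordinates. *)
Lemma dominant_component : exists P, [/\ is_prime_ideal P, I `<=` P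
  & alg_indep_mod P base_coords].
Proof.
pose S : set A := [set p | exists2 c, c != 0 & p = mmap (@mpolyC 8 K) base_coords c].
have [||||P [primeP IP PS]] := @prime_avoiding _ I S.
- exact: ideal_gen_ideal.
- by exists 1; rewrite ?oner_eq0 ?rmorph1.
- move=> p q [c c0 ->] [d d0 ->]; exists (c * d); first by rewrite mulf_neq0.
  by rewrite rmorphM.
- move=> p Ip [c c0 pE]; rewrite {}pE in Ip.
  pose a : {mpoly K[4]} := 'X_(@Ordinal 4 0 isT).
  pose z : {mpoly K[4]} := 'X_(@Ordinal 4 2 isT).
  pose q : {mpoly K[4]} := 'X_(@Ordinal 4 3 isT).
  pose lead := z * (a ^+ 2 - a * z * q + z ^+ 2).
  have leadE v : lead.@[v] = v (@Ordinal 4 2 isT) * (v (@Ordinal 4 0 isT) ^+ 2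
      - v (@Ordinal 4 0 isT) * v (@Ordinal 4 2 isT) * v (@Ordinal 4 3 isT)
      + v (@Ordinal 4 2 isT) ^+ 2).
    by rewrite /lead !(rmorphM, rmorphD, rmorphN, rmorphXn) /= !mevalXU.
  have lead0 : lead != 0.
    apply/eqP => /(congr1 (meval (fun i : 'I_4 => (i == 2%N :> nat)%:R))).
    rewrite leadE /= meval0 => lead_eq0; case/eqP: (oner_neq0 K).
    by rewrite -lead_eq0; ring.
  have [v] := mpoly_nonvanishing K_char0 (mulf_neq0 c0 lead0).
  rewrite rmorphM /= leadE !mulf_eq0 !negb_or => /and3P [cv z0 av0].
  have [r [p' Iv]] := fiber_nonempty (v (@Ordinal 4 1 isT)) z0 av0.
  have /Iv /= := Ip; rewrite evpt_base_coords => /eqP; apply/negP.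
  rewrite (meval_eq (v2 := v)) // => -[[|[|[|[|i]]]] lti] //=;
    by congr v; apply: val_inj.
exists P; split=> // c Pc; apply/eqP; apply: contrapT => /negP c0.
by apply: PS Pc _; exists c.
Qed.

Lemma height_ge_leq (P : set A) h h' : (h' <= h)%N -> height_ge P h -> height_ge P h'.
Proof.
move=> le_h'h [Q [primeQ strictQ QP]]; exists (fun i => Q (i + (h - h'))%N).
split=> [i lei|i lti|]; last by rewrite subnKC.
- by apply: primeQ; rewrite -[X in (_ <= X)%N](subnKC le_h'h) leq_add2r.
- by rewrite addSn; apply: strictQ; rewrite -[X in (_ < X)%N](subnKC le_h'h) ltn_add2r.
Qed.

Lemma rel_rep_codimension c : codimension I c <-> c = 4.
Proof.
have [P [primeP IP indP]] := dominant_component.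
split=> [[allP [P' [primeP' IP' nhP']]]|->].
  apply/eqP; rewrite eqn_leq -(leq_add2r 4).
  rewrite (height_trdeg (allP P primeP IP) indP) /=.
  rewrite leqNgt; apply/negP => ltc4; apply: nhP'.
  exact: height_ge_leq ltc4 (rel_rep_height_ge primeP' IP').
split=> [Q primeQ IQ|]; first exact: (rel_rep_height_ge primeQ IQ).
exists P; split; [exact: primeP | exact: IP | move=> hP].
by have := height_trdeg hP indP.
Qed.

Lemma rel_rep_smoothE : smooth (rel_rep_gens b1 b2) <->
  ideal_gen (I `|` jacobian_minors (rel_rep_gens b1 b2) 4) = [set: A].
Proof.
split=> [sm|smE c /rel_rep_codimension -> //].
by apply: sm; apply/rel_rep_codimension.
Qed.

End Locus.

(** * Points where the gradients of the trace sum and product are parallel *)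

Section CriticalLocus.
Variables (F : fieldType) (a b c p q r u v m : F).
Hypothesis two_neq0 : 2%:R != 0 :> F.

Let S := c * r + b * q + a * p - a * b * c.
Let Pi := a ^+ 2 + b ^+ 2 + c ^+ 2 + p ^+ 2 + q ^+ 2 + r ^+ 2
  - a * b * r - a * c * q - b * c * p + p * q * r - 4%:R.
Hypothesis sum_uv : S = u + v.
Hypothesis prod_uv : Pi = u * v.

Lemma psi2_origin :
  [/\ a = 0, b = 0 & c = 0] -> [/\ p = 0, q = 0 & r = 0] -> psi2 u v = 0.
Proof.
move=> [a0 b0 c0] [p0 q0 r0].
have vE : v = - u.
  by apply/eqP; rewrite -subr_eq0 opprK addrC -sum_uv /S a0 b0 c0; apply/eqP; ring.
have : u ^+ 2 - 4%:R = 0.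
  have : u * v = - 4%:R by rewrite -prod_uv /Pi a0 b0 c0 p0 q0 r0; ring.
  by rewrite vE => /(congr1 -%R) E; rewrite -[4%:R]opprK -E; ring.
by rewrite /psi2 => ->; rewrite !mul0r.
Qed.

(** Here [u - 2 k] or [v - 2 k] vanishes, as their product is
    [Pi - 2 k S + 4]. *)
Lemma psi2_diagonal (k : F) : k ^+ 2 = 1 ->
  [/\ p = k * a, q = k * b & r = k * c] -> psi2 u v = 0.
Proof.
move=> k2 [pE qE rE].
have : (u - 2%:R * k) * (v - 2%:R * k) = 0.
  transitivity (Pi - 2%:R * k * S + 4%:R * k ^+ 2).
    by rewrite prod_uv sum_uv; ring.
  have k3 : k ^+ 3 = k by rewrite exprS k2 mulr1.
  transitivity ((k ^+ 2 - 1) * (4%:R - (a ^+ 2 + b ^+ 2 + c ^+ 2)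
     + k * a * b * c)); last by rewrite k2; ring.
  by rewrite /Pi /S pE qE rE; ring.
have k4 : (2%:R * k) ^+ 2 = 4%:R by rewrite exprMn k2; ring.
rewrite /psi2 => /eqP; rewrite mulf_eq0 !subr_eq0 => /orP [] /eqP ->.
  by rewrite k4; ring.
by rewrite k4; ring.
Qed.

Hypothesis dPi_a : 2%:R * a - b * r - c * q = m * (p - b * c).
Hypothesis dPi_b : 2%:R * b - a * r - c * p = m * (q - a * c).
Hypothesis dPi_c : 2%:R * c - a * q - b * p = m * (r - a * b).
Hypothesis dPi_p : 2%:R * p - b * c + q * r = m * a.
Hypothesis dPi_q : 2%:R * q - a * c + p * r = m * b.
Hypothesis dPi_r : 2%:R * r - a * b + p * q = m * c.

(** Below, [Gij] are the nontrivial entries of the Gram matrix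

      2   a   b   c
      a   2   G12 G13
      b   G12 2   G23
      c   G13 G23 2

    of [1, F1, F2, F3], whose determinant is [S ^ 2 - 4 Pi = (u - v) ^ 2], and
    [Cij] are its cofactors.  Those off the diagonal are half the derivatives of
    the determinant with respect to the entries, and so are expressed through
    the gradients of [S] and [Pi]; the hypotheses turn them into multiples of
    [th = S - 2 m].  The relations [Rij] are entries of the product of the
    matrix and its adjugate. *)
Lemma psi2_of_critical : psi2 u v = 0.
Proof.
have discE : (u - v) ^+ 2 = S ^+ 2 - 4%:R * Pi by rewrite prod_uv sum_uv; ring.
pose th := S - 2%:R * m.
pose G12 := a * b - r; pose G13 := a * c - q; pose G23 := b * c - p.
pose C11 := 8%:R + 2%:R * b * c * G23 - 2%:R * b ^+ 2 - 2%:R * c ^+ 2 - 2%:R * G23 ^+ 2.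
pose C22 := 8%:R + 2%:R * a * c * G13 - 2%:R * a ^+ 2 - 2%:R * c ^+ 2 - 2%:R * G13 ^+ 2.
pose C33 := 8%:R + 2%:R * a * b * G12 - 2%:R * a ^+ 2 - 2%:R * b ^+ 2 - 2%:R * G12 ^+ 2.
pose C23 := 2%:R * (2%:R * p - b * c + q * r) - S * a.
pose C13 := 2%:R * (2%:R * q - a * c + p * r) - S * b.
pose C12 := 2%:R * (2%:R * r - a * b + p * q) - S * c.
pose C01 := - S * G23 - 2%:R * (2%:R * a - b * r - c * q) - b * C12 - c * C13.
pose C02 := - S * G13 - 2%:R * (2%:R * b - a * r - c * p) - a * C12 - c * C23.
pose C03 := - S * G12 - 2%:R * (2%:R * c - a * q - b * p) - a * C13 - b * C23.
have R01 : 2%:R * C01 + a * C11 + b * C12 + c * C13 = 0.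
  by rewrite /C01 /C11 /C12 /C13 /G23 /S; ring.
have R02 : 2%:R * C02 + a * C12 + b * C22 + c * C23 = 0.
  by rewrite /C02 /C12 /C22 /C23 /G13 /S; ring.
have R03 : 2%:R * C03 + a * C13 + b * C23 + c * C33 = 0.
  by rewrite /C03 /C13 /C23 /C33 /G12 /S; ring.
have R11 : a * C01 + 2%:R * C11 + G12 * C12 + G13 * C13 = S ^+ 2 - 4%:R * Pi.
  by rewrite /C01 /C11 /C12 /C13 /G23 /G12 /G13 /Pi /S; ring.
have R22 : b * C02 + G12 * C12 + 2%:R * C22 + G23 * C23 = S ^+ 2 - 4%:R * Pi.
  by rewrite /C02 /C22 /C12 /C23 /G23 /G12 /G13 /Pi /S; ring.
have R33 : c * C03 + G13 * C13 + G23 * C23 + 2%:R * C33 = S ^+ 2 - 4%:R * Pi.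
  by rewrite /C03 /C33 /C13 /C23 /G23 /G12 /G13 /Pi /S; ring.
have R12 : a * C02 + 2%:R * C12 + G12 * C22 + G13 * C23 = 0.
  by rewrite /C02 /C12 /C22 /C23 /G12 /G13 /S; ring.
have R13 : a * C03 + 2%:R * C13 + G12 * C23 + G13 * C33 = 0.
  by rewrite /C03 /C13 /C33 /C23 /G12 /G13 /S; ring.
have R23 : b * C03 + G12 * C13 + 2%:R * C23 + G23 * C33 = 0.
  by rewrite /C03 /C13 /C33 /C23 /G12 /G13 /G23 /S; ring.
have C23E : C23 = - th * a by rewrite /C23 dPi_p /th; ring.
have C13E : C13 = - th * b by rewrite /C13 dPi_q /th; ring.
have C12E : C12 = - th * c by rewrite /C12 dPi_r /th; ring.
have C01E : C01 = th * (p + b * c).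
  by rewrite /C01 dPi_a C12E C13E /th /G23; ring.
have C02E : C02 = th * (q + a * c).
  by rewrite /C02 dPi_b C12E C23E /th /G13; ring.
have C03E : C03 = th * (r + a * b).
  by rewrite /C03 dPi_c C13E C23E /th /G12; ring.
(* The three diagonal relations [R11, R22, R33] have the same off-diagonal part,
   so [C11 = C22 = C33]. *)
pose d := S ^+ 2 - 4%:R * Pi - th * S.
have C11E : 2%:R * C11 = d.
  by rewrite /d -R11 C01E C12E C13E /S /G12 /G13; ring.
have C22E : 2%:R * C22 = d.
  by rewrite /d -R22 C02E C12E C23E /S /G12 /G23; ring.
have C33E : 2%:R * C33 = d.
  by rewrite /d -R33 C03E C13E C23E /S /G13 /G23; ring.
have pd : 4%:R * th * p = - (a * d).
  apply/eqP; rewrite -subr_eq0 -C11E; apply/eqP.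
  by rewrite -[RHS](mulr0 2%:R) -R01 C01E C12E C13E; ring.
have qd : 4%:R * th * q = - (b * d).
  apply/eqP; rewrite -subr_eq0 -C22E; apply/eqP.
  by rewrite -[RHS](mulr0 2%:R) -R02 C02E C12E C23E; ring.
have rd : 4%:R * th * r = - (c * d).
  apply/eqP; rewrite -subr_eq0 -C33E; apply/eqP.
  by rewrite -[RHS](mulr0 2%:R) -R03 C03E C13E C23E; ring.
have [disc0|disc_neq0] := eqVneq (S ^+ 2 - 4%:R * Pi) 0.
  by rewrite /psi2 discE disc0 mulr0.
have four_neq0 : 4%:R != 0 :> F by rewrite (_ : 4 = 2 * 2)%N // natrM mulf_neq0.
(* If [th = 0] the adjugate is diagonal and invertible, so the Gram matrix is
   diagonal and all six coordinates vanish. *)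
have [th0|th_neq0] := eqVneq th 0.
  have d_neq0 : d != 0 by rewrite /d th0 mul0r subr0.
  have a0 : a = 0.
    move/esym/eqP: pd; rewrite th0 mulr0 mul0r oppr_eq0 mulf_eq0 (negPf d_neq0) orbF.
    by move/eqP.
  have b0 : b = 0.
    move/esym/eqP: qd; rewrite th0 mulr0 mul0r oppr_eq0 mulf_eq0 (negPf d_neq0) orbF.
    by move/eqP.
  have c0 : c = 0.
    move/esym/eqP: rd; rewrite th0 mulr0 mul0r oppr_eq0 mulf_eq0 (negPf d_neq0) orbF.
    by move/eqP.
  apply: psi2_origin; split => //.
  - have : p * d = 0.
      transitivity (- 2%:R * (b * C03 + G12 * C13 + 2%:R * C23 + G23 * C33)); last by rewrite R23 mulr0.
      by rewrite -C33E C23E C13E th0 b0 a0 /G23 b0; ring.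
    by move/eqP; rewrite mulf_eq0 (negPf d_neq0) orbF => /eqP.
  - have : q * d = 0.
      transitivity (- 2%:R * (a * C03 + 2%:R * C13 + G12 * C23 + G13 * C33)); last by rewrite R13 mulr0.
      by rewrite -C33E C23E C13E th0 a0 /G13 a0; ring.
    by move/eqP; rewrite mulf_eq0 (negPf d_neq0) orbF => /eqP.
  - have : r * d = 0.
      transitivity (- 2%:R * (a * C02 + 2%:R * C12 + G12 * C22 + G13 * C23)); last by rewrite R12 mulr0.
      by rewrite -C22E C23E C12E th0 a0 /G12 a0; ring.
    by move/eqP; rewrite mulf_eq0 (negPf d_neq0) orbF => /eqP.
(* Otherwise [(p, q, r) = k (a, b, c)], and the relations [R12, R13, R23] read
   [(k ^ 2 - 1) c = (k ^ 2 - 1) b = (k ^ 2 - 1) a = 0] up to a nonzero factor. *)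
have th4_neq0 : 4%:R * th != 0 by rewrite mulf_neq0.
pose k := - d / (4%:R * th).
have pk : p = k * a by rewrite /k mulrAC; apply: canRL (mulfK th4_neq0) _; rewrite mulrC pd; ring.
have qk : q = k * b by rewrite /k mulrAC; apply: canRL (mulfK th4_neq0) _; rewrite mulrC qd; ring.
have rk : r = k * c by rewrite /k mulrAC; apply: canRL (mulfK th4_neq0) _; rewrite mulrC rd; ring.
have dk : d = - (4%:R * th * k) by rewrite /k mulrC divfK ?opprK.
have coord_eq0 x : 4%:R * th * (x * (k ^+ 2 - 1)) = 0 -> k ^+ 2 != 1 -> x = 0.
  move/eqP; rewrite mulf_eq0 (negPf th4_neq0) mulf_eq0 subr_eq0 /=.
  by move=> /orP [/eqP-> //|->].
have [k1|k_neq1] := eqVneq (k ^+ 2) 1; first exact: (psi2_diagonal k1).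
have c0 : c = 0.
  apply: coord_eq0 k_neq1; rewrite -[RHS](mulr0 2%:R) -R12.
  transitivity (2%:R * (a * C02 + 2%:R * C12 + G13 * C23) + G12 * (2%:R * C22)); last by ring.
  by rewrite C22E dk C02E C12E C23E /G13 /G12 qk rk; ring.
have b0 : b = 0.
  apply: coord_eq0 k_neq1; rewrite -[RHS](mulr0 2%:R) -R13.
  transitivity (2%:R * (a * C03 + 2%:R * C13 + G12 * C23) + G13 * (2%:R * C33)); last by ring.
  by rewrite C33E dk C03E C13E C23E /G13 /G12 qk rk; ring.
have a0 : a = 0.
  apply: coord_eq0 k_neq1; rewrite -[RHS](mulr0 2%:R) -R23.
  transitivity (2%:R * (b * C03 + 2%:R * C23 + G12 * C13) + G23 * (2%:R * C33)); last by ring.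
  by rewrite C33E dk C03E C13E C23E /G23 /G12 pk rk; ring.
by apply: psi2_origin; split=> //; rewrite ?pk ?qk ?rk ?a0 ?b0 ?c0 mulr0.
Qed.

End CriticalLocus.

(** * The Jacobian matrix *)

Section Gradients.
Variable R : comNzRingType.
Implicit Types a b c p q r : R.

(** The partial derivatives of [S] and [Pi] with respect to
    [x1, x2, x3, x12, x13, x23], in this order, which is that of the variables
    [a, b, c, r, q, p]. *)
Definition grad_sum a b c p q r : seq R :=
  [:: p - b * c; q - a * c; r - a * b; c; b; a].

Definition grad_prod a b c p q r : seq R :=
  [:: 2%:R * a - b * r - c * q; 2%:R * b - a * r - c * p; 2%:R * c - a * q - b * p;
      2%:R * r - a * b + p * q; 2%:R * q - a * c + p * r; 2%:R * p - b * c + q * r].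
End Gradients.

Section JacobianEntries.
Variables (K : fieldType) (S : comNzRingType) (f : {rmorphism {mpoly K[8]} -> S}).
Local Notation gradS := (grad_sum (f (x1 K)) (f (x2 K)) (f (x3 K)) (f (x23 K)) (f (x13 K)) (f (x12 K))).
Local Notation gradPi := (grad_prod (f (x1 K)) (f (x2 K)) (f (x3 K)) (f (x23 K)) (f (x13 K)) (f (x12 K))).

Lemma mderiv_var n (i j : 'I_n) : ('X_i : {mpoly K[n]})^`M(j) = (i == j)%:R.
Proof.
rewrite mderivX mnm1E; case: eqP => [->|_]; last by rewrite scale0r.
rewrite scale1r (_ : (U_(j) - U_(j))%MM = 0%MM) ?mpolyX0 //.
by apply/mnmP => k; rewrite mnmBE mnm0E subnn.
Qed.

Lemma us_deriv (i : 'I_8) : (i < 6)%N -> f ((us K)^`M(i)) = - gradS`_i.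
Proof.
by elim/ord8_ind: i => // _;
  rewrite /us !(mderivB, mderivD, mderivM, mderiv_var) /=
     !(rmorphB, rmorphD, rmorphM, rmorph1, rmorph0) /=; ring.
Qed.

Lemma us_deriv_t (i : 'I_8) : (6 <= i)%N -> f ((us K)^`M(i)) = 1.
Proof.
by elim/ord8_ind: i => // _;
  rewrite /us !(mderivB, mderivD, mderivM, mderiv_var) /=
     !(rmorphB, rmorphD, rmorphM, rmorph1, rmorph0) /=; ring.
Qed.

Lemma u2_deriv (i : 'I_8) : (i < 6)%N ->
  f ((u2 K)^`M(i)) = f (t1 K) * gradS`_i - gradPi`_i.
Proof.
by elim/ord8_ind: i => // _;
  rewrite /u2 -!mpolyC_nat !expr2 !(mderivB, mderivD, mderivM, mderivC, mderiv_var) /=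
     !(mul0r, mulr0, mul1r, mulr1, add0r, addr0, subr0)
     !(rmorphB, rmorphD, rmorphM, rmorph1, rmorph0) /=; ring.
Qed.

Lemma u2_deriv_t2 : f ((u2 K)^`M(@Ordinal 8 7 isT)) = 0.
Proof.
by rewrite /u2 -!mpolyC_nat !expr2 !(mderivB, mderivD, mderivM, mderivC, mderiv_var) /=
     !(rmorphB, rmorphD, rmorphM, rmorph1, rmorph0) /=; ring.
Qed.
End JacobianEntries.

(** A nonzero row vector killed by the Jacobian matrix at [v] is, up to a
    permutation of its entries, killed by every maximal minor. *)
Lemma jacobian_minor_root (K : fieldType) n k (phi : k.-tuple {mpoly K[n]})
    (v : 'I_n -> K) (w : 'rV[K]_k) :
    w != 0 -> w *m map_mx (meval v) (jacobian phi) = 0 ->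
  forall m, jacobian_minors phi k m -> m.@[v] = 0.
Proof.
move=> w0 wJ _ [f [g [incf incg ->]]].
have injf : injective f.
  move=> i j fij; apply: val_inj; case: (ltngtP i j) => // /incf; by rewrite fij ltnn.
rewrite -det_map_mx; apply/eqP/det0P; exists (\row_i w 0 (f i)).
  apply: contra w0 => /eqP w'0; apply/eqP/rowP => i; rewrite mxE.
  have [finv _ finvK] := injF_bij injf.
  by have /rowP/(_ (finv i)) := w'0; rewrite !mxE finvK.
apply/rowP => j; have /rowP/(_ (g j)) := wJ; rewrite !mxE => wJg; rewrite -[RHS]wJg.
rewrite [RHS](reindex_inj injf) /=; apply: eq_bigr => i _.
by rewrite !mxE.
Qed.

Lemma big_ord4 (V : nmodType) (E : 'I_4 -> V) :
  \sum_i E i = E (@Ordinal 4 0 isT) + E (@Ordinal 4 1 isT)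
    + E (@Ordinal 4 2 isT) + E (@Ordinal 4 3 isT).
Proof.
rewrite !big_ord_recr big_ord0 /= add0r.
by congr (E _ + E _ + E _ + E _); apply: val_inj.
Qed.

(** * Smoothness and the vanishing of psi2 *)

Section Smoothness.
Variables (K : fieldType) (b1 b2 : K).
Hypothesis K_char0 : forall n, n.+1%:R != 0 :> K.
Hypothesis K_sqrt : forall x : K, exists y, y ^+ 2 = x.
Local Notation A := {mpoly K[8]}.
Local Notation gens := (rel_rep_gens b1 b2).
Local Notation I := (generated_ideal gens).

Lemma jacobianE (S : comNzRingType) (f : {rmorphism A -> S}) (j : 'I_8) :
  [/\ f (jacobian gens (@Ordinal 4 0 isT) j) = (j == 6%N :> nat)%:R,
      f (jacobian gens (@Ordinal 4 1 isT) j) = (j == 7%N :> nat)%:R,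
      f (jacobian gens (@Ordinal 4 2 isT) j) = f ((u2 K)^`M(j))
    & f (jacobian gens (@Ordinal 4 3 isT) j) = f ((us K)^`M(j))].
Proof.
rewrite !mxE /tnth /=; split=> //.
- rewrite mderivB mderivC subr0 mderiv_var eq_sym -val_eqE /=.
  by rewrite rmorph_nat.
- rewrite mderivB mderivC subr0 mderiv_var eq_sym -val_eqE /=.
  by rewrite rmorph_nat.
Qed.

Definition minor_cols (i j : 'I_8) (k : 'I_4) : 'I_8 :=
  nth i [:: i; j; @Ordinal 8 6 isT; @Ordinal 8 7 isT] k.

(** The minor on the columns [i, j] and those of [t1, t2] is used.  Where it
    vanishes there is a relation between its four rows; the columns of [t1] and
    [t2] show that it is a nontrivial relation between the rows of [u2] and
    [us], which gives the equation. *)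
Lemma gradients_parallel (F : fieldType) (f : {rmorphism A -> F}) (i j : 'I_8) :
    (i < 6)%N -> (j < 6)%N ->
    (forall m, jacobian_minors gens 4 m -> f m = 0) ->
  f ((u2 K)^`M(i)) * f ((us K)^`M(j)) = f ((u2 K)^`M(j)) * f ((us K)^`M(i)).
Proof.
move=> lti ltj minors0; wlog ltij : i j lti ltj / (i < j)%N.
  move=> wl; have [/wl->//|/wl->//|/val_inj->//] := ltngtP i j.
have /eqP : f (\det (mxsub id (minor_cols i j) (jacobian gens))) = 0.
  apply: minors0; exists id, (minor_cols i j); split=> //.
  have := (leqW lti, leqW ltj).
  by move=> [lti7 ltj7] [[|[|[|[|k]]]] ltk] [[|[|[|[|l]]]] ltl].
rewrite -det_map_mx => /det0P [w w0 /rowP wJ].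
have row4 k : \sum_l w 0 l * f (jacobian gens l (minor_cols i j k)) = 0.
  have := wJ k; rewrite !mxE => wJk; rewrite -[RHS]wJk.
  by apply: eq_bigr => l _; rewrite !mxE.
pose w0' := w 0 (@Ordinal 4 0 isT); pose w1 := w 0 (@Ordinal 4 1 isT).
pose w2 := w 0 (@Ordinal 4 2 isT); pose w3 := w 0 (@Ordinal 4 3 isT).
have row4E k : w0' * (minor_cols i j k == 6%N :> nat)%:R
     + w1 * (minor_cols i j k == 7%N :> nat)%:R
     + w2 * f ((u2 K)^`M(minor_cols i j k)) + w3 * f ((us K)^`M(minor_cols i j k)) = 0.
  have [e0 e1 e2 e3] := jacobianE f (minor_cols i j k).
  by rewrite -[RHS](row4 k) big_ord4 e0 e1 e2 e3.
have := row4E (@Ordinal 4 0 isT); have := row4E (@Ordinal 4 1 isT).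
have := row4E (@Ordinal 4 2 isT); have := row4E (@Ordinal 4 3 isT).
rewrite /minor_cols /= !(ltn_eqF (leqW lti)) !(ltn_eqF (leqW ltj)).
rewrite (@us_deriv_t _ _ f (@Ordinal 8 6 isT)) // (@us_deriv_t _ _ f (@Ordinal 8 7 isT)) //.
rewrite u2_deriv_t2 (ltn_eqF lti) (ltn_eqF ltj).
rewrite !(mulr0, mulr1, add0r, addr0) => e7 e6 ej ei.
have w23 : (w2 != 0) || (w3 != 0).
  rewrite -negb_and; apply: contra w0 => /andP [/eqP w20 /eqP w30].
  move: e7 e6; rewrite w20 w30 mul0r !addr0 => w10 w00.
  apply/eqP/rowP => -[[|[|[|[|k]]]] ltk]; rewrite ?mxE //.
  - by rewrite -w00; congr (w 0 _); apply: val_inj.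
  - by rewrite -w10; congr (w 0 _); apply: val_inj.
  - by rewrite -w20; congr (w 0 _); apply: val_inj.
  - by rewrite -w30; congr (w 0 _); apply: val_inj.
move: ei ej; set X := f _; set Y := f _; set X' := f _; set Y' := f _ => ei ej.
case/orP: w23 => wn0; apply: (mulfI wn0); apply/eqP; rewrite -subr_eq0; apply/eqP.
  transitivity ((w2 * X + w3 * Y) * Y' - (w2 * X' + w3 * Y') * Y); first by ring.
  by rewrite ei ej !mul0r subrr.
transitivity ((w2 * X' + w3 * Y') * X - (w2 * X + w3 * Y) * X'); first by ring.
by rewrite ei ej !mul0r subrr.
Qed.

(** If the gradient of [us] does not vanish, that of [u2] is a multiple of it,
    which makes the gradients of [S] and [Pi] parallel; if it vanishes, so do
    all six coordinates. *)
Lemma critical_psi2 (F : fieldType) (f : {rmorphism A -> F}) :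
    (forall p, I p -> f p = 0) ->
    (forall m, jacobian_minors gens 4 m -> f m = 0) -> psi2 b1 b2 = 0.
Proof.
move=> I0 minors0.
have gen i : f (tnth gens i) = 0 by apply: I0; apply: sub_ideal_gen; apply: mem_tnth.
have ft1 := gen (@Ordinal 4 0 isT); have ft2 := gen (@Ordinal 4 1 isT).
have fu2 := gen (@Ordinal 4 2 isT); have fus := gen (@Ordinal 4 3 isT).
rewrite /tnth /= in ft1 ft2 fu2 fus.
pose fC : {rmorphism K -> F} := f \o @mpolyC 8 K.
have ft1E : f (t1 K) = fC b1 by apply/eqP; rewrite -subr_eq0 /= -rmorphB ft1.
have ft2E : f (t2 K) = fC b2 by apply/eqP; rewrite -subr_eq0 /= -rmorphB ft2.
have two0 : 2%:R != 0 :> F by rewrite -(rmorph_nat fC) fmorph_eq0 K_char0.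
have parallel (i j : 'I_8) := @gradients_parallel _ f i j.
suff : psi2 (f (t1 K)) (f (t2 K)) = 0.
  rewrite ft1E ft2E => psi0; apply/eqP; rewrite -(fmorph_eq0 fC) -psi0 /psi2.
  by rewrite !(rmorphM, rmorphB, rmorphXn, rmorph_nat).
move: fu2 fus; rewrite u2_morph us_morph.
have dus := us_deriv f; have du2 := u2_deriv f.
set a := f (x1 K) in dus du2 *; set b := f (x2 K) in dus du2 *.
set c := f (x3 K) in dus du2 *; set r := f (x12 K) in dus du2 *.
set q := f (x13 K) in dus du2 *; set p := f (x23 K) in dus du2 *.
set u := f (t1 K) in du2 *; set v := f (t2 K) => fu2 fus.
have sum_uv : c * r + b * q + a * p - a * b * c = u + v.
  by apply/esym/eqP; rewrite -subr_eq0 fus.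
have prod_uv : a ^+ 2 + b ^+ 2 + c ^+ 2 + p ^+ 2 + q ^+ 2 + r ^+ 2
    - a * b * r - a * c * q - b * c * p + p * q * r - 4%:R = u * v.
  have -> : v = c * r + b * q + a * p - a * b * c - u by rewrite sum_uv; ring.
  by apply/eqP; rewrite -subr_eq0 -oppr_eq0 -fu2; apply/eqP; ring.
have [/existsP [j0 /andP [ltj0 Yj0]]|] := boolP [exists j : 'I_8, (j < 6)%N && (f ((us K)^`M(j)) != 0)].
  pose la := - f ((u2 K)^`M(j0)) / f ((us K)^`M(j0)).
  have lagrange (i : 'I_8) : (i < 6)%N ->
      (grad_prod a b c p q r)`_i = (u - la) * (grad_sum a b c p q r)`_i.
    move=> lti; have := parallel i j0 lti ltj0 minors0.
    have : f ((u2 K)^`M(j0)) = - la * f ((us K)^`M(j0)) by rewrite /la mulNr divfK // opprK.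
    move=> -> /eqP; rewrite mulrAC -subr_eq0 -mulrBl mulf_eq0 (negPf Yj0) orbF.
    rewrite du2 // dus // => /eqP e; apply/esym/eqP.
    by rewrite -subr_eq0; apply/eqP; rewrite -[RHS]e; ring.
  apply: (psi2_of_critical two0 sum_uv prod_uv (m := u - la)).
  - exact: (lagrange (@Ordinal 8 0 isT)).
  - exact: (lagrange (@Ordinal 8 1 isT)).
  - exact: (lagrange (@Ordinal 8 2 isT)).
  - exact: (lagrange (@Ordinal 8 5 isT)).
  - exact: (lagrange (@Ordinal 8 4 isT)).
  - exact: (lagrange (@Ordinal 8 3 isT)).
move=> /existsPn noY.
have Y0 (i : 'I_8) : (i < 6)%N -> (grad_sum a b c p q r)`_i = 0.
  move=> lti; have := noY i; rewrite lti /= negbK dus // oppr_eq0 => /eqP //.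
have c0 : c = 0 := Y0 (@Ordinal 8 3 isT) isT.
have b0 : b = 0 := Y0 (@Ordinal 8 4 isT) isT.
have a0 : a = 0 := Y0 (@Ordinal 8 5 isT) isT.
have := (Y0 (@Ordinal 8 0 isT) isT, Y0 (@Ordinal 8 1 isT) isT, Y0 (@Ordinal 8 2 isT) isT).
rewrite /= a0 b0 c0 !mul0r !subr0 => -[[p0 q0] r0].
exact: (psi2_origin sum_uv prod_uv).
Qed.

Lemma smooth_of_psi2 : psi2 b1 b2 != 0 -> smooth gens.
Proof.
move=> psi0; apply/rel_rep_smoothE => //.
set J := ideal_gen _; have idJ : is_ideal J by exact: ideal_gen_ideal.
suff J1 : J 1.
  by apply/seteqP; split=> // p _; rewrite -[p]mulr1; case: idJ => _ _; apply.
apply: contrapT => nJ1.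
have [||p Jp p1|P [primeP JP _]] := @prime_avoiding _ J [set 1] idJ.
- by [].
- by move=> p q -> ->; rewrite /= mulr1.
- by apply: nJ1; rewrite -p1.
have [F [f fP]] := residue_field primeP.
have fJ p : (I `|` jacobian_minors gens 4) p -> f p = 0.
  by move=> Hp; apply/fP/JP; apply: sub_ideal_gen.
case/eqP: psi0; apply: (critical_psi2 (f := f)) => p Hp; apply: fJ.
  by left.
by right.
Qed.

(** The coefficients of [t1 - b1] and [t2 - b2] in the relation between the rows
    of the Jacobian matrix are those that cancel the columns of [t1] and [t2]. *)
Lemma singular_of_critical s (la : K) :
    s`_6 = b1 -> s`_7 = b2 -> evpt s (u2 K) = 0 -> evpt s (us K) = 0 ->
    (forall i : 'I_8, (i < 6)%N -> evpt s ((u2 K)^`M(i)) + la * evpt s ((us K)^`M(i)) = 0) ->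
  singular gens.
Proof.
move=> s6 s7 u20 us0 crit /(rel_rep_smoothE b1 b2 K_char0 K_sqrt) JT.
have [idV V1 _] := prime_evpt s; apply: V1.
suff : [set: A] `<=` [set p | evpt s p = 0] by apply.
rewrite -JT; apply: ideal_gen_min => // p [Ip|].
  by move: p Ip; apply: rel_rep_ideal_point => //; rewrite ?evpt_t1 ?evpt_t2 ?s6 ?s7 subrr.
pose w : 'rV[K]_4 := \row_i nth 0 [:: - evpt s ((u2 K)^`M(@Ordinal 8 6 isT)) - la; - la; 1; la] i.
apply: (@jacobian_minor_root _ _ _ _ _ w).
  apply/eqP => /rowP/(_ (@Ordinal 4 2 isT)); rewrite !mxE /= => /eqP.
  by rewrite oner_eq0.
apply/rowP => j; rewrite [LHS]mxE [RHS]mxE big_ord4 ![map_mx _ _ _ _]mxE.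
have [e0 e1 e2 e3] := jacobianE (evpt s) j.
rewrite e0 e1 e2 e3 !mxE /=.
have [ltj6|le6j] := ltnP j 6.
  rewrite (ltn_eqF ltj6) (ltn_eqF (leqW ltj6)) !mulr0 !add0r mul1r.
  exact: crit.
rewrite us_deriv_t // {e0 e1 e2 e3}; elim/ord8_ind: j le6j => //= _.
  by ring.
by rewrite u2_deriv_t2; ring.
Qed.

(** The critical point has [x1 = x2 = x13 = x23 = 0] and [x12 = k * x3]; then
    [S = k * x3 ^ 2] fixes [x3] up to sign, and the gradients are parallel with
    ratio [2 k]. *)
Lemma singular_of_diagonal k : k ^+ 2 = 1 ->
  (b1 - 2%:R * k) * (b2 - 2%:R * k) = 0 -> singular gens.
Proof.
move=> k2 bk0; have [c cE] := K_sqrt (k * (b1 + b2)).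
pose s := [:: 0; 0; c; k * c; 0; 0; b1; b2].
apply: (@singular_of_critical s (b1 - 2%:R * k)) => //.
- rewrite evpt_u2 /=.
  transitivity (4%:R - b1 ^+ 2 - c ^+ 2 + k * b1 * c ^+ 2 - k ^+ 2 * c ^+ 2); first by ring.
  rewrite cE; transitivity ((b1 - 2%:R * k) * (b2 - 2%:R * k)
    + (k ^+ 2 - 1) * (b1 ^+ 2 + b1 * b2 - 4%:R - k * (b1 + b2))); first by ring.
  by rewrite bk0 k2; ring.
- rewrite evpt_us /=; transitivity (b1 + b2 - k * c ^+ 2); first by ring.
  by rewrite cE mulrA -expr2 k2; ring.
move=> i; elim/ord8_ind: i => // _; rewrite us_deriv // u2_deriv //= !evptX /=; try by ring.
by transitivity (2%:R * c * (k ^+ 2 - 1)); [ring | rewrite k2; ring].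
Qed.

(** The point is the representation with [F1 = F2 = 1] and [tr F3 = b1]. *)
Lemma singular_of_equal : b1 = b2 -> singular gens.
Proof.
move=> b12; pose s := [:: 2%:R; 2%:R; b1; 2%:R; b1; b1; b1; b2].
apply: (@singular_of_critical s 0) => //.
- by rewrite evpt_u2 /=; ring.
- by rewrite evpt_us /= -b12; ring.
by move=> i; elim/ord8_ind: i => // _; rewrite us_deriv // u2_deriv //= !evptX /=; ring.
Qed.

Lemma singular_iff_psi2 : singular gens <-> psi2 b1 b2 = 0.
Proof.
split=> [sing|/eqP].
  by apply/eqP; apply: contrapT => /negP /smooth_of_psi2.
have factor (b : K) : b ^+ 2 - 4%:R = (b - 2%:R * 1) * (b - 2%:R * (-1)) by ring.
rewrite /psi2 !factor expr2 !mulf_eq0 -!orbA orbb.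
have k1 : (1 : K) ^+ 2 = 1 by rewrite expr1n.
have kN1 : (-1 : K) ^+ 2 = 1 by rewrite sqrrN expr1n.
case/or4P=> [/eqP e|/eqP e|/eqP e|/orP [/eqP e|]].
- by apply: (singular_of_diagonal k1); rewrite e mul0r.
- by apply: (singular_of_diagonal kN1); rewrite e mul0r.
- by apply: (singular_of_diagonal k1); rewrite e mulr0.
- by apply: (singular_of_diagonal kN1); rewrite e mulr0.
by rewrite subr_eq0 => /eqP /singular_of_equal.
Qed.
End Smoothness.

Theorem mainTheorem3 (R : realType) (b1 b2 : R[i]) :
  singular (rel_rep_gens b1 b2) <-> psi2 b1 b2 = 0.
Proof.
apply: singular_iff_psi2 => [n|x]; first by rewrite pnatr_eq0.
by exists (sqrtC x); rewrite sqrtCK.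
Qed.
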